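(* Let $\mathbb{F}$ be a field, let $n\ge 1$, and let $a_1,\dots,a_n$ be non-zero elements of $\mathbb{F}$. Let $T$ be a transitive tournament on $[n]=\{1,\dots,n\}$, and let $M_T(\mathbf{a})$ be the $n\times n$ symmetric matrix over $\mathbb{F}$ with all diagonal entries zero and, for $1\le i<j\le n$, $M_T(\mathbf{a})(i,j)=M_T(\mathbf{a})(j,i)=a_i$ if $i\to j$ in $T$ and $=a_j$ if $j\to i$ in $T$. Then \[ \operatorname{rank}(M_T(\mathbf{a}))\ \ge\ \Bigl\lfloor \tfrac{2n}{3}\Bigr\rfloor - 1, \] where rank is taken over $\mathbb{F}$.
   Context: A tournament on $[n]$ is an orientation of the complete graph on $[n]$: for each pair $i\neq j$ exactly one of $i\to j$, $j\to i$ holds. A tournament $T$ is transitive if there is a total order $\prec$ on $[n]$ such that $i\to j$ whenever $i\prec j$. Here $\mathbf{a}=(a_1,\dots,a_n)$. *)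

(* Defs.v *)
From mathcomp Require Import all_boot all_algebra.

Set Implicit Arguments.
Unset Strict Implicit.
Unset Printing Implicit Defensive.

Import GRing.Theory.
Local Open Scope ring_scope.

(* [T i j] means that the edge between i and j is oriented i -> j. *)
Definition tournament (V : finType) (T : rel V) : Prop :=
  irreflexive T /\ (forall i j : V, i != j -> T i j (+) T j i).

Definition strict_total_order (V : finType) (prec : rel V) : Prop :=
  [/\ irreflexive prec, transitive prec
    & forall i j : V, i != j -> prec i j || prec j i].

Definition transitive_tournament (V : finType) (T : rel V) : Prop :=
  tournament T /\
  exists prec : rel V,
    strict_total_order prec /\ (forall i j : V, prec i j -> T i j).

Definition tournament_mx (F : fieldType) (n : nat) (T : rel 'I_n)
    (a : 'I_n -> F) : 'M[F]_n :=
  \matrix_(i, j)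
    if (i < j)%N then (if T i j then a i else a j)
    else if (j < i)%N then (if T j i then a j else a i)
    else 0.

(* Main.v *)
Require Import Defs.
From mathcomp Require Import all_boot all_algebra.
From mathcomp Require Import zify.

(** List the vertices along the total order, so that the matrix has (i, j)
entry [b (min i j)] off the diagonal. Subtracting from each row the next one
gives rows [(0, ..., 0, - b i, ...)], an echelon form; hence the rank is
actually at least [n - 1], which is at least [2n/3 - 1]. *)

Set Implicit Arguments.
Unset Strict Implicit.
Unset Printing Implicit Defensive.

Import GRing.Theory.
Local Open Scope ring_scope.

(** Sort all vertices by the reflexive closure [le], which is total. As the sorted list has no
    duplicates, its order is strict. *)
Lemma strict_total_order_enum (n : nat) (prec : rel 'I_n) :
  strict_total_order prec ->
  exists s : 'I_n -> 'I_n, forall i j : 'I_n, (i < j)%N -> prec (s i) (s j).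
Proof.
case=> _ prec_trans prec_total.
pose le := [rel x y | (x == y) || prec x y].
have le_total : total le.
  move=> x y /=; rewrite [y == x]eq_sym.
  by case: eqVneq => //= /prec_total.
have le_trans : transitive le.
  move=> y x z /= /predU1P[-> //|xy] /predU1P[<-|yz]; first by rewrite xy orbT.
  by rewrite (prec_trans _ _ _ xy yz) orbT.
pose r := sort le (enum 'I_n).
have size_r : size r = n by rewrite size_sort size_enum_ord.
have uniq_r : uniq r by rewrite sort_uniq enum_uniq.
exists (fun i => nth i r i) => i j lt_ij.
(* Each index served as its own default value, so a common default is needed first. *)
rewrite (set_nth_default i j) ?size_r //.
have := sorted_ltn_nth le_trans i (sort_sorted le_total (enum 'I_n)).
move=> /(_ i j); rewrite -/r !inE size_r !ltn_ord => /(_ isT isT lt_ij) /=.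
by rewrite nth_uniq ?size_r // (ltn_eqF lt_ij).
Qed.

(** Selecting rows and columns amounts to multiplying on both sides by selections from the
    identity. *)
Lemma mxrank_mxsub_leq (F : fieldType) (m n p q : nat)
    (f : 'I_p -> 'I_m) (g : 'I_q -> 'I_n) (A : 'M[F]_(m, n)) :
  (\rank (mxsub f g A) <= \rank A)%N.
Proof.
have -> : mxsub f g A = rowsub f 1%:M *m A *m colsub g 1%:M.
  by rewrite -rowsubE mulmx_colsub mulmx1; apply/matrixP => i j; rewrite !mxE.
by rewrite (leq_trans (mxrankM_maxl _ _)) ?mxrankM_maxr.
Qed.

Lemma mxrank_min_mx (F : fieldType) (n : nat) (b : 'I_n.+1 -> F)
    (M : 'M[F]_n.+1) :
    (forall i, b i != 0) -> (forall i, M i i = 0) ->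
    (forall i j : 'I_n.+1, (i < j)%N -> M i j = b i /\ M j i = b i) ->
  (n <= \rank M)%N.
Proof.
move=> b_neq0 M_diag M_off.
pose f := widen_ord (leqnSn n); pose g := lift (@ord0 n).
(* Here [g] is the successor of [f]: [U] holds the row differences with the last column dropped,
   hence is square. *)
pose U := (rowsub f 1%:M - rowsub g 1%:M) *m M *m colsub f 1%:M.
have UE i j : U i j = M (f i) (f j) - M (g i) (f j).
  by rewrite /U mulmxBl -!rowsubE mulmx_colsub mulmx1 !mxE.
have U_trig : is_trig_mx U^T.
  apply/is_trig_mxP => i j lt_ij; rewrite mxE UE.
  (* Below the diagonal, column [f i] of [M] is constant, so the difference vanishes. *)
  have [_ ->] := M_off (f i) (f j) lt_ij.
  have [_ ->] : M (f i) (g j) = b (f i) /\ M (g j) (f i) = b (f i).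
    by apply: M_off; rewrite /= /bump /= add1n ltnS ltnW.
  by rewrite subrr.
have U_unit : U \in unitmx.
  rewrite unitmxE -det_tr (det_trig U_trig) unitfE.
  apply/prodf_neq0 => i _; rewrite mxE UE M_diag.
  have [_ ->] : M (f i) (g i) = b (f i) /\ M (g i) (f i) = b (f i).
    by apply: M_off; rewrite /= /bump /= add1n.
  by rewrite sub0r oppr_eq0.
rewrite -{1}(mxrank_unit U_unit).
by rewrite (leq_trans (mxrankM_maxl _ _)) ?mxrankM_maxr.
Qed.

Theorem theorem1 (F : fieldType) (n : nat) (hn : (1 <= n)%N)
    (a : 'I_n -> F) (ha : forall i : 'I_n, a i != 0)
    (T : rel 'I_n) (hT : transitive_tournament T) :
  ((2 * n) %/ 3 - 1 <= \rank (tournament_mx T a))%N.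
Proof.
case: n hn a ha T hT => // n _ a ha T [[T_irr T_xor] [prec [prec_sto precT]]].
(* From here on there are [n.+1] vertices. *)
apply: (@leq_trans n); first lia.
have [s s_mono] := strict_total_order_enum prec_sto.
apply: leq_trans (mxrank_mxsub_leq s s _).
apply: (mxrank_min_mx (b := a \o s)) => [i|i|i j lt_ij] /=.
- exact: ha.
- by rewrite !mxE ltnn.
have T_ij : T (s i) (s j) by rewrite precT ?s_mono.
have neq_ij : s i != s j by apply/eqP => E; rewrite E T_irr in T_ij.
have := T_xor _ _ neq_ij; rewrite T_ij /= => /negbTE T_ji.
(* The edge leaves [s i], so both entries are [a (s i)] whichever of the labels [s i], [s j] is
   smaller. *)
rewrite !mxE T_ij T_ji.
by case: (ltngtP (s i) (s j)) => // /val_inj E; rewrite E eqxx in neq_ij.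
Qed.
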